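(* Define $F(t,s)=1+\sum_{n\ge k\ge 1}E(2n,k)t^ns^k$. Then \[ F(t,s)=\frac{\sin(\pi\sqrt{1-s}\sqrt{t})}{\sqrt{1-s}\,\sin(\pi\sqrt{t})}, \] where the right-hand side is understood via its expansion as a power series in $t$ and $s$ (it involves only integral powers of $t$ and $s$).
   Context: For positive integers $i_1,\dots,i_k$ with $i_1>1$, $\zeta(i_1,\dots,i_k)=\sum_{n_1>\dots>n_k\ge 1} n_1^{-i_1}\cdots n_k^{-i_k}$. For $1\le k\le n$, $E(2n,k)$ denotes the sum of $\zeta(i_1,\dots,i_k)$ over all $k$-tuples $(i_1,\dots,i_k)$ of positive even integers with $i_1+\dots+i_k=2n$. *)

(* Defs.v *)
(* MathComp-Analysis, over an arbitrary [R : realType]; the complex numbers are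
   [R[i]] from mathcomp-real-closed, with the topology of its norm carried by
   [R[i]^o]. *)
From HB Require Import structures.
From mathcomp Require Import all_boot all_order all_algebra.
From mathcomp Require Import complex.
From mathcomp Require Import all_classical all_reals all_analysis.

Set Implicit Arguments.
Unset Strict Implicit.
Unset Printing Implicit Defensive.

Import Order.TTheory GRing.Theory Num.Theory.
Import numFieldNormedType.Exports.

Local Open Scope classical_set_scope.
Local Open Scope ring_scope.
Local Open Scope complex_scope.

(* The series is an unordered sum over all n_1 > ... > n_k >= 1.  It converges
   if and only if i_1 > 1 when all i_j >= 1 and k >= 1; [fine] sends a divergent
   sum to 0. *)
Definition mzeta (R : realType) (k : nat) (i : k.-tuple nat) : R :=
  fine (\esum_(n in [set n : k.-tuple nat |
                     sorted gtn n /\ all (fun m => 0 < m)%N n])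
    (\prod_(j < k) ((tnth n j)%:R ^- tnth i j))%:E).

(* [evenzeta_sum R N k] is E(N, k).  Letting the i_j range over 'I_N.+1 loses
   nothing, since they are positive integers with sum N. *)
Definition evenzeta_sum (R : realType) (N k : nat) : R :=
  \sum_(i : k.-tuple 'I_N.+1 |
        all (fun m : 'I_N.+1 => (0 < m)%N && ~~ odd m) i
        && (\sum_(j < k) (tnth i j : nat) == N)%N)
    mzeta R (map_tuple (@nat_of_ord N.+1) i).

(* The coefficient of t^n s^k in F(t,s). *)
Definition F_coef (R : realType) (n k : nat) : R :=
  if (n == 0)%N && (k == 0)%N then 1
  else if (1 <= k <= n)%N then evenzeta_sum R n.*2 k
  else 0.

(* The complex sine, by the same power series as the real [sin]. *)
Definition csin (R : realType) (z : R[i]) : R[i] :=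
  lim (series (fun n : nat => (sin_coeff (1 : R) n)%:C * z ^+ n : R[i]^o) @ \oo).

(* The power series with coefficients [c] is the expansion at (0,0) of [g]: on
   some punctured bidisc it converges absolutely, with sum [g t s].  The line
   t = 0 is left out because [g] may be a quotient with a removable singularity
   there; the coefficients are still determined by [g]. *)
Definition power_series_expansion (R : realType)
    (c : nat -> nat -> R) (g : R[i] -> R[i] -> R[i]) : Prop :=
  exists2 r : R, 0 < r &
    forall t s : R[i], t != 0 -> `|t| < r%:C -> `|s| < r%:C ->
      summable [set: nat * nat]
        (fun p => (complex.Re `|(c p.1 p.2)%:C * t ^+ p.1 * s ^+ p.2|)%:E)
      /\ (fun N : nat =>
            \sum_(n < N) \sum_(k < N) (c n k)%:C * t ^+ n * s ^+ k : R[i]^o)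
           @ \oo --> (g t s : R[i]^o).

(* Main.v *)
(* Distinguishing whether n_1 = j shows that F(t,s) is the limit of the products
   over j <= M of 1 + s (t/j^2) / (1 - t/j^2)
     = (1 - (1-s) t/j^2) / (1 - t/j^2),
   so the claim follows from Euler's product for the sine, applied to t and to
   (1-s) t.  The coefficients of the finite products increase with M and are at
   most 4 2^n, so the power series are dominated uniformly in M for |t| < 1/4.
   Euler's product comes from the polynomial identity (N = 2m+1)
     sum_k C(N,2k+1) (-z)^k = N prod_(1 <= j <= m) (1 - z cot^2(j pi/N)),
   de Moivre's formula providing the roots.  At z = pi^2 w / N^2 the left side
   over N tends to the sine series, while 1/x^2 - 1 <= cot^2 x <= 1/x^2 places
   the right side within O(1/N) of the product of the 1 - w/j^2. *)
Require Import Defs.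
From HB Require Import structures.
From mathcomp Require Import all_boot all_order all_algebra.
From mathcomp Require Import complex.
From mathcomp Require Import all_classical all_reals all_analysis.
From mathcomp Require Import zify ring lra.

Import Order.TTheory GRing.Theory Num.Theory.
Import numFieldNormedType.Exports.
Import Normc.

Local Open Scope ring_scope.
Local Open Scope complex_scope.

(** * The modulus on [R[i]]: estimates and convergence criteria *)

Section ComplexModulus.
Context {R : realType}.
Local Open Scope classical_set_scope.
Implicit Types z w : R[i].

Lemma norm_normc z : `|z| = (normc z)%:C.
Proof. by []. Qed.

Lemma normc_ge0 z : 0 <= normc z.
Proof. by rewrite -lecR; exact: (@normr_ge0 _ R[i]). Qed.

Lemma normc_real (x : R) : normc x%:C = `|x|.
Proof. by rewrite /= expr0n /= addr0 sqrtr_sqr. Qed.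

Lemma normcX z n : normc (z ^+ n) = normc z ^+ n.
Proof. by elim: n => [|n IH]; rewrite ?normc1// !exprS normcM IH. Qed.

Lemma normc_sum (I : Type) (r : seq I) (P : pred I) (F : I -> R[i]) :
  normc (\sum_(i <- r | P i) F i) <= \sum_(i <- r | P i) normc (F i).
Proof.
elim/big_rec2 : _ => [|i y x _ le_xy]; first by rewrite normc0.
exact: le_trans (le_normcD _ _) (lerD _ _).
Qed.

Lemma normc_prod (I : Type) (r : seq I) (P : pred I) (F : I -> R[i]) :
  normc (\prod_(i <- r | P i) F i) = \prod_(i <- r | P i) normc (F i).
Proof. by elim/big_rec2 : _ => [|i y x _ <-]; rewrite ?normc1 ?normcM. Qed.

Lemma normcBC z w : normc (z - w) = normc (w - z).
Proof. by rewrite -normcN opprB. Qed.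

Lemma normc_Re z : `|complex.Re z| <= normc z.
Proof. by rewrite -lecR; exact: normc_ge_Re. Qed.

Lemma normc_Im z : `|complex.Im z| <= normc z.
Proof.
case: z => a b /=; rewrite -sqrtr_sqr ler_wsqrtr// lerDr; exact: sqr_ge0.
Qed.

Lemma cvg_normc (u : nat -> R[i]^o) (l : R[i]^o) :
  (normc (u n - l) @[n --> \oo] --> (0 : R)) <-> (u @ \oo --> l).
Proof.
split=> h.
  apply/cvgrPdist_lt => -[e e'] /[dup]; rewrite ltcE /= => /andP[/eqP -> e0] _.
  have /cvgrPdist_lt/(_ e e0) := h.
  apply: filterS => n; rewrite sub0r normrN ger0_norm ?normc_ge0// => hn.
  by rewrite norm_normc ltcR normcBC.
apply/cvgrPdist_lt => e e0.
have /cvgrPdist_lt/(_ e%:C) := h.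
rewrite ltcR => /(_ e0); apply: filterS => n; rewrite norm_normc ltcR.
by rewrite sub0r normrN ger0_norm ?normc_ge0// normcBC.
Qed.

Lemma normc_squeeze (u : nat -> R[i]^o) (l : R[i]^o) (v : nat -> R) :
  (forall n, normc (u n - l) <= v n) -> v @ \oo --> (0 : R) -> u @ \oo --> l.
Proof.
move=> uv v0; apply/cvg_normc; apply: (squeeze_cvgr _ (cvg_cst 0) v0).
by apply: nearW => n; rewrite normc_ge0 uv.
Qed.

(** The triangle inequality through [u n] and [v n] adds two errors that vanish in the limit. This
    carries estimates uniform in an index over to limits. *)
Lemma normc_lim_le (u v : nat -> R[i]^o) (a b : R[i]^o) (C : R) :
  u @ \oo --> a -> v @ \oo --> b -> (forall n, normc (u n - v n) <= C) ->
  normc (a - b) <= C.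
Proof.
move=> /cvg_normc ua /cvg_normc vb uvC; rewrite -[leRHS]addr0 -[0]addr0 addrA.
have h : C + normc (u n - a) + normc (v n - b) @[n --> \oo] --> C + 0 + 0.
  by apply: cvgD => //; apply: cvgD => //; exact: cvg_cst.
rewrite -(cvg_lim (@Rhausdorff R) h); apply: limr_ge.
  by apply/cvg_ex; exists (C + 0 + 0).
apply: nearW => n.
have -> : a - b = (u n - v n) - (u n - a) + (v n - b) by ring.
apply: le_trans (le_normcD _ _) (lerD _ _) => //.
by apply: le_trans (le_normcD _ _) (lerD (uvC n) _); rewrite normcN.
Qed.

(* [R[i]^o] carries no completeness instance, hence the detour through the
   real and imaginary parts. *)
Lemma cvg_series_normc (u : nat -> R[i]^o) (v : nat -> R) :
  (forall n, normc (u n) <= v n) -> cvgn (series v) ->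
  exists l : R[i]^o, series u @ \oo --> l.
Proof.
move=> uv cv.
have cvg_part (f : R[i] -> R) : (forall z, `|f z| <= normc z) ->
    cvgn (series (f \o u : nat -> R^o)).
  move=> fle; apply: normed_cvg; apply: series_le_cvg cv => n /=.
  - exact: normr_ge0.
  - exact: le_trans (normc_ge0 _) (uv n).
  - exact: le_trans (fle _) (uv n).
have /cvg_ex[a ha] := cvg_part _ normc_Re.
have /cvg_ex[b hb] := cvg_part _ normc_Im.
exists (a +i* b : R[i]).
have ReIm z : normc z <= `|complex.Re z| + `|complex.Im z|.
  case: z => x y /=; rewrite -[leRHS]ger0_norm ?addr_ge0// -sqrtr_sqr.
  rewrite ler_wsqrtr//.
  rewrite sqrrD !real_normK ?num_real// addrAC lerDl mulrn_wge0// mulr_ge0//.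
pose v' (n : nat) := `|a - series (@complex.Re R \o u : nat -> R^o) n|
  + `|b - series (@complex.Im R \o u : nat -> R^o) n|.
refine (@normc_squeeze (series u) (a +i* b) v' _ _) => [n|]; last first.
  have dist0 (f : nat -> R^o) (c : R^o) :
      f @ \oo --> c -> `|c - f k| @[k --> \oo] --> (0 : R).
    move=> fc; rewrite -(normr0 R^o) -(subrr c); apply: cvg_norm.
    by apply: cvgB => //; exact: cvg_cst.
  by rewrite -[0](addr0 (0 : R)); apply: cvgD; exact: dist0.
rewrite /v'; apply: le_trans (ReIm _) _.
rewrite !(distrC _ (series _ _)) /series /=.
rewrite (_ : complex.Re _ = \sum_(0 <= k < n) complex.Re (u k) - a); last first.
  by rewrite raddfB (raddf_sum (@complex.Re R : Rcomplex R -> R)).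
rewrite (_ : complex.Im _ = \sum_(0 <= k < n) complex.Im (u k) - b) //.
by rewrite raddfB (raddf_sum (@complex.Im R : Rcomplex R -> R)).
Qed.
End ComplexModulus.

(** * The product formula with squared cotangents *)

Section CotangentProduct.
Context {R : realType}.

(** The mean value theorem gives sin x = x cos c with 0 < c < x; the cosine is at most 1 and
    decreases on [0, pi]. *)
Lemma sin_bounds (x : R) : 0 < x -> x <= pi -> x * cos x <= sin x <= x.
Proof.
move=> x0 xpi.
have [|c] := @MVT R sin cos 0 x x0 (fun y _ => is_derive_sin y).
  by apply: continuous_subspaceT => y; exact: continuous_sin.
rewrite in_itv /= sin0 !subr0 => /andP[c0 cx] ->; rewrite mulrC.
rewrite ler_pM2r// ler_piMl ?cos_le1 ?(ltW x0)// andbT.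
rewrite ltW// ltr_cos// in_itv /=.
- by rewrite (ltW c0) (le_trans (ltW cx)).
- by rewrite (ltW x0).
Qed.

Lemma de_moivre (x : R) n :
  (cos x +i* sin x) ^+ n = cos (n%:R * x) +i* sin (n%:R * x).
Proof.
elim: n => [|n IH]; first by rewrite mul0r cos0 sin0.
rewrite exprS IH -natr1 mulrDl mul1r (addrC _ x) cosD sinD; simpc.
by congr (_ +i* _); rewrite addrC mulrC.
Qed.

Lemma sum_double (V : nmodType) (F : nat -> V) n :
  \sum_(i < n.*2) F i = \sum_(k < n) (F k.*2 + F k.*2.+1).
Proof.
elim: n => [|n IH]; first by rewrite !big_ord0.
by rewrite doubleS !big_ord_recr /= IH addrA.
Qed.

(** The even powers of [y] cancel in the difference and the odd ones double. *)
Lemma odd_binomial (K : comNzRingType) (x y : K) m :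
  (x + y) ^+ m.*2.+1 - (x - y) ^+ m.*2.+1 =
  2 * \sum_(k < m.+1)
    'C(m.*2.+1, k.*2.+1)%:R * x ^+ (m - k).*2 * y ^+ k.*2.+1.
Proof.
rewrite exprDn exprBn -sumrB.
rewrite (@sum_double _ (fun i => x ^+ (m.*2.+1 - i) * y ^+ i *+ 'C(m.*2.+1, i) -
   (-1) ^+ i * x ^+ (m.*2.+1 - i) * y ^+ i *+ 'C(m.*2.+1, i)) m.+1).
rewrite mulr_sumr; apply: eq_bigr => k _.
have -> : (-1) ^+ k.*2 = 1 :> K by rewrite -signr_odd odd_double.
have -> : (-1) ^+ k.*2.+1 = -1 :> K by rewrite -signr_odd /= odd_double.
rewrite mul1r subrr add0r (_ : m.*2.+1 - k.*2.+1 = (m - k).*2)%N; last first.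
  by rewrite subSS doubleB.
rewrite -mulr_natl -[X in _ - X]mulr_natl.
by move: (x ^+ _) (y ^+ _) ('C(_, _)%:R) => a b c; ring.
Qed.

Definition cot2 m j : R :=
  (cos (j%:R * pi / m.*2.+1%:R) / sin (j%:R * pi / m.*2.+1%:R)) ^+ 2.

Lemma cot2_angle m j : (0 < j <= m)%N ->
  0 < (j%:R * pi / m.*2.+1%:R : R) < pi / 2.
Proof.
move=> /andP[j0 jm]; rewrite divr_gt0 ?mulr_gt0 ?pi_gt0 ?ltr0n//=.
rewrite ltr_pdivrMr ?ltr0n// mulrAC ltr_pdivlMr// mulrAC -mulrA mulrC.
rewrite (mulrC 2) -mulrA ltr_pM2l ?pi_gt0// -natrM ltr_nat.
rewrite mul2n ltnS leq_double//.
Qed.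

Lemma cot2_sin_gt0 m j : (0 < j <= m)%N ->
  0 < sin (j%:R * pi / m.*2.+1%:R : R).
Proof. by move=> /cot2_angle; exact: sin_gt0_pihalf. Qed.

Lemma cot2_sinV m j : (0 < j <= m)%N ->
  cot2 m j = (sin (j%:R * pi / m.*2.+1%:R)) ^- 2 - 1.
Proof.
move=> jm; have s0 := cot2_sin_gt0 _ _ jm; rewrite /cot2.
set x := j%:R * pi / _ in s0 *.
rewrite expr_div_n cos2sin2 mulrBl mul1r divff// expf_neq0// gt_eqF//.
Qed.

(** Since cot^2 = sin^-2 - 1 and the sines are positive, equal values force equal sines; the angles
    lie in (0, pi/2), where the sine is injective. *)
Lemma cot2_inj m : {in [pred j | 0 < j <= m]%N &, injective (cot2 m)}.
Proof.
move=> j k; rewrite !inE => jm km; rewrite !cot2_sinV// => /addIr /invr_inj.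
have [sj sk] := (cot2_sin_gt0 _ _ jm, cot2_sin_gt0 _ _ km).
move=> /eqP; rewrite eqrXn2 ?ltW// => /eqP /sin_inj.
have itv i : (0 < i <= m)%N ->
    (i%:R * pi / m.*2.+1%:R : R) \in `[(- (pi / 2)), (pi / 2)].
  move=> /cot2_angle/andP[h1 h2]; rewrite in_itv /= (ltW h2) andbT.
  by rewrite (le_trans _ (ltW h1))// oppr_le0 divr_ge0 ?pi_ge0.
move=> /(_ (itv _ jm) (itv _ km)) /divIf; rewrite pnatr_eq0 => /(_ isT).
move=> /mulIf; rewrite gt_eqF ?pi_gt0// => /(_ isT) /eqP.
by rewrite eqr_nat => /eqP.
Qed.

(** With x = j pi/N and N = 2m+1, de Moivre and sin(Nx) = 0 make the N-th powers of cos x + i sin x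
    and of its conjugate equal, so the sum in [odd_binomial] vanishes. *)
Lemma cot2_root m j : (0 < j <= m)%N ->
  \sum_(k < m.+1)
    'C(m.*2.+1, k.*2.+1)%:R * (-1) ^+ k * (cot2 m j)%:C ^+ (m - k) = 0 :> R[i].
Proof.
move=> jm; have s0 := cot2_sin_gt0 _ _ jm; rewrite /cot2.
set x := j%:R * pi / _ in s0 *.
have Nx : m.*2.+1%:R * x = j%:R * pi.
  by rewrite /x mulrC divfK// pnatr_eq0.
have sN : sin (j%:R * pi : R) = 0.
  by elim: {jm x s0 Nx} j => [|j IH];
    rewrite ?mul0r ?sin0// -natr1 mulrDl mul1r sinDpi IH oppr0.
pose c := (cos x)%:C; pose y : R[i] := 'i * (sin x)%:C.
have cy : c + y = cos x +i* sin x by rewrite /c /y; simpc.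
have cyN : c - y = cos (- x) +i* sin (- x) by rewrite cosN sinN /c /y; simpc.
have := @odd_binomial R[i] c y m.
rewrite cy cyN !de_moivre mulrN cosN sinN Nx sN oppr0 subrr => /esym/eqP.
rewrite mulf_eq0 pnatr_eq0 /= => /eqP H.
have s0C : (sin x)%:C != 0 by rewrite fmorph_eq0 gt_eqF.
have y0 : y != 0 by rewrite mulf_neq0// eq_complex /= oner_eq0 andbF.
(* Each term of the vanishing sum is y sin^(2m) x times a term of the goal: y^(2k+1) = y (-1)^k
   sin^(2k) x, and cos^(2(m-k)) x = cot^(2(m-k)) x sin^(2(m-k)) x. *)
apply: (mulfI (_ : y * (sin x)%:C ^+ m.*2 != 0)).
  by rewrite mulf_neq0// expf_neq0.
rewrite mulr0 -[RHS]H mulr_sumr; apply: eq_bigr => k _.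
have km : (k <= m)%N by rewrite -ltnS.
rewrite -{1}(subnK km) doubleD exprD !rmorphXn /= rmorphM /= fmorphV /=.
have -> : y ^+ k.*2.+1 = y * ((-1) ^+ k * (sin x)%:C ^+ k.*2).
  rewrite exprS -!mul2n !exprM; congr (_ * _); rewrite -exprMn; congr (_ ^+ _).
  by rewrite exprMn sqr_i.
rewrite -!mul2n !exprM -/c; set a := (sin x)%:C ^+ 2.
have -> : c ^+ 2 ^+ (m - k) = ((c / (sin x)%:C) ^+ 2) ^+ (m - k) * a ^+ (m - k).
  by rewrite -exprMn -exprMn divfK.
move: (a ^+ (m - k)) (a ^+ k) ((-1) ^+ k) ('C(_, _)%:R) => A B e f.
by move: ((c / _) ^+ 2 ^+ (m - k)) => g; ring.
Qed.

(** For z nonzero the left side is z^m p(1/z), where [p] has the coefficients in reverse order. This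
    [p] has degree m and leading coefficient 2m+1, and [cot2_root] and [cot2_inj] provide m distinct
    roots, so it splits. *)
Lemma cot2_product m (z : R[i]) :
  \sum_(k < m.+1) 'C(m.*2.+1, k.*2.+1)%:R * (- z) ^+ k =
  m.*2.+1%:R * \prod_(j < m) (1 - z * (cot2 m j.+1)%:C).
Proof.
have [->|z0] := eqVneq z 0.
  rewrite oppr0 big_ord_recl /= expr0 mulr1 bin1 big1 ?addr0 => [|i _].
    by rewrite big1 ?mulr1// => i _; rewrite mul0r subr0.
  by rewrite exprS mul0r mulr0.
pose p := \poly_(i < m.+1)
  ('C(m.*2.+1, (m - i).*2.+1)%:R * (-1) ^+ (m - i) : R[i]).
have pE x : p.[x] = \sum_(k < m.+1)
    'C(m.*2.+1, k.*2.+1)%:R * (-1) ^+ k * x ^+ (m - k).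
  rewrite horner_poly [RHS](reindex_inj rev_ord_inj) /=.
  by apply: eq_bigr => i _; rewrite subSS subKn// -ltnS.
have sp : size p = m.+1 by rewrite size_poly_eq// subnn bin1 mulr1.
have lp : lead_coef p = m.*2.+1%:R.
  by rewrite lead_coefE sp coef_poly ltnSn subnn bin1 mulr1.
pose rs := [seq (cot2 m j)%:C | j <- iota 1 m].
have pfac : p = m.*2.+1%:R *: \prod_(x <- rs) ('X - x%:P).
  rewrite -lp; apply: all_roots_prod_XsubC.
  - by rewrite sp size_map size_iota.
  - apply/allP => x /mapP[j]; rewrite mem_iota add1n ltnS => jm ->.
    by rewrite rootE pE cot2_root.
  - rewrite uniq_rootsE map_inj_in_uniq ?iota_uniq// => j k.
    by rewrite !mem_iota !add1n !ltnS => jm km /complexI; exact: cot2_inj.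
transitivity (z ^+ m * p.[z^-1]).
  rewrite pE mulr_sumr; apply: eq_bigr => k _.
  have km : (k <= m)%N by rewrite -ltnS.
  rewrite (exprNn z) exprVn (_ : z ^+ m = z ^+ (m - k) * z ^+ k); last first.
    by rewrite -exprD subnK.
  have : z ^+ (m - k) != 0 by rewrite expf_neq0.
  move: (z ^+ (m - k)) ((-1) ^+ k) (z ^+ k) ('C(_, _)%:R) => a b c d a0.
  by field.
rewrite pfac hornerZ horner_prod mulrCA; congr (_ * _).
rewrite /rs big_map (iotaDl 1 0) big_map.
rewrite (_ : iota 0 m = index_iota 0 m) ?big_mkord; last first.
  by rewrite /index_iota subn0.
rewrite -[X in z ^+ X]card_ord -prodr_const -big_split /=.
by apply: eq_bigr => j _; rewrite hornerXsubC mulrBr divff// add1n.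
Qed.
End CotangentProduct.

(** * Euler's product for the sine, near 0 *)

Section EulerProduct.
Context {R : realType}.
Local Open Scope classical_set_scope.

(** The induction runs on the sharper bound 4(m+1)/(m+2) for m+1 factors; with y = m+2 its step
    amounts to (y-1)(y^2+1)(y+1) = y^4 - 1 <= y^4. *)
Lemma prodD_invsq_le4 m : \prod_(j < m) (1 + (j.+1%:R ^+ 2)^-1) <= 4 :> R.
Proof.
case: m => [|m]; first by rewrite big_ord0; lra.
suff : \prod_(j < m.+1) (1 + (j.+1%:R ^+ 2)^-1) <= 4 * m.+1%:R / m.+2%:R :> R.
  move=> /le_trans; apply; rewrite ler_pdivrMr ?ltr0n// ler_pM2l// ler_nat//.
elim: m => [|m IH]; first by rewrite big_ord1 expr1n invr1; lra.
rewrite big_ord_recr /=.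
apply: le_trans (ler_wpM2r _ IH) _.
  by rewrite addr_ge0// invr_ge0 sqr_ge0.
have -> : m.+1%:R = m.+2%:R - 1 :> R by rewrite -[in RHS]natr1 addrK.
have -> : m.+3%:R = m.+2%:R + 1 :> R by rewrite natr1.
have : 0 < m.+2%:R :> R by rewrite ltr0n.
set y := m.+2%:R => y0.
rewrite ler_pdivlMr; last by lra.
have -> : 4 * (y - 1) / y * (1 + (y ^+ 2)^-1) * (y + 1) = 4 * y - 4 / y ^+ 3.
  by field; rewrite gt_eqF.
by rewrite gerBl divr_ge0// exprn_ge0// ltW.
Qed.

(** The factors are exchanged one at a time; [1 <= D j] allows the bound for the factor left out to
    be put back. *)
Lemma prod_dist (x y : nat -> R[i]) (D : nat -> R) m :
  (forall j, (j < m)%N ->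
    1 <= D j /\ normc (x j) <= D j /\ normc (y j) <= D j) ->
  normc (\prod_(j < m) x j - \prod_(j < m) y j) <=
  \prod_(j < m) D j * \sum_(j < m) normc (x j - y j).
Proof.
elim: m => [|m IH] h; first by rewrite !big_ord0 subrr normc0 mulr0.
have [Dm [xm ym]] := h m (ltnSn m).
have {}h j : (j < m)%N -> 1 <= D j /\ normc (x j) <= D j /\ normc (y j) <= D j.
  by move=> jm; apply: h; exact: leqW.
rewrite !big_ord_recr /=.
set X := \prod_(j < m) x j; set Y := \prod_(j < m) y j in IH *.
have -> : X * x m - Y * y m = (X - Y) * x m + Y * (x m - y m) by ring.
have Y_le : normc Y <= \prod_(j < m) D j.
  rewrite normc_prod.
  by apply: ler_prod => j _; rewrite normc_ge0 (h j (ltn_ord j)).2.2.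
have D1 : 0 <= \prod_(j < m) D j by exact: le_trans (normc_ge0 _) Y_le.
apply: le_trans (le_normcD _ _) _; rewrite !normcM mulrDr; apply: lerD.
  by rewrite mulrAC; apply: ler_pM; rewrite ?normc_ge0 ?IH.
apply: ler_wpM2r; first exact: normc_ge0.
apply: le_trans Y_le _.
by rewrite ler_peMr.
Qed.

(** The falling factorial differs from the power only at lower order in [N]. The induction closes
    because (k+1)^2 + (k+1) <= (k+2)^2. *)
Lemma ffact_lower N k : (N ^ k.+1 <= N ^_ k.+1 + k.+1 ^ 2 * N ^ k)%N.
Proof.
elim: k => [|k IH]; first by rewrite ffactn1 expn1 leq_addr.
rewrite expnS; apply: leq_trans (leq_mul (leqnn N) IH) _.
rewrite mulnDr (ffactnSr N k.+1) mulnCA -expnS.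
have h1 : (N <= (N - k.+1) + k.+1)%N by rewrite addnC -leq_subLR.
have h2 : (N ^_ k.+1 <= N ^ k.+1)%N.
  by elim: k.+1 => // i IHi; rewrite ffactnSr expnSr leq_mul// leq_subr.
have h3 : (k.+1 ^ 2 + k.+1 <= k.+2 ^ 2)%N by rewrite !expnS !expn0; lia.
have := leq_mul h1 (leqnn (N ^_ k.+1)); rewrite mulnDl (mulnC (N - _)%N).
have := leq_mul (leqnn k.+1) h2.
have := leq_mul h3 (leqnn (N ^ k.+1)); rewrite mulnDl.
lia.
Qed.

(** By [ffact_lower] the difference is at most (k+1)^2 / ((k+1)! N), and (k+1)^2 <= 2 (k+1)!. The
    bound is uniform in [k]. *)
Lemma bin_approx N k : (0 < N)%N ->
  `|(k.+1)`!%:R^-1 - 'C(N, k.+1)%:R / N%:R ^+ k.+1| <= 2 / N%:R :> R.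
Proof.
move=> N0; have f0 : 0 < (k.+1)`!%:R :> R by rewrite ltr0n fact_gt0.
have n0 : 0 < N%:R :> R by rewrite ltr0n.
have -> : 'C(N, k.+1)%:R = (N ^_ k.+1)%:R / (k.+1)`!%:R :> R.
  by rewrite -bin_ffact natrM mulfK// gt_eqF.
have h1 : (N ^_ k.+1 <= N ^ k.+1)%N.
  by elim: k.+1 => // i IHi; rewrite ffactnSr expnSr leq_mul// leq_subr.
have h2 := ffact_lower N k.
have h3 : (k.+1 ^ 2 <= 2 * (k.+1)`!)%N.
  rewrite factS expnS expn1 mulnCA leq_mul//.
  case: k {h1 h2 f0} => // k; have := fact_geq k.+1; lia.
have {}h1 : (N ^_ k.+1)%:R <= N%:R ^+ k.+1 :> R by rewrite -natrX ler_nat.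
have {}h2 : N%:R ^+ k.+1 <= (N ^_ k.+1)%:R + k.+1%:R ^+ 2 * N%:R ^+ k :> R.
  by rewrite -!natrX -natrM -natrD ler_nat.
have {}h3 : k.+1%:R ^+ 2 <= 2 * (k.+1)`!%:R :> R.
  by rewrite -natrX -natrM ler_nat.
move: f0 n0 h1 h2 h3; rewrite exprS.
move: (k.+1)`!%:R (N ^_ k.+1)%:R N%:R (k.+1%:R ^+ 2) => F A n B f0 n0 h1 h2 h3.
set P := n ^+ k in h1 h2 *.
have P0 : 0 < P by rewrite exprn_gt0.
have -> : F^-1 - A / F / (n * P) = (n * P - A) / (F * (n * P)).
  by field; rewrite !gt_eqF.
rewrite ger0_norm; last by rewrite divr_ge0 ?subr_ge0// !mulr_ge0// ltW.
rewrite ler_pdivrMr ?mulr_gt0//.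
have -> : 2 / n * (F * (n * P)) = 2 * F * P by field; rewrite gt_eqF.
by rewrite lerBlDl (le_trans h2)// lerD2l ler_wpM2r// ltW.
Qed.

(** With x = j pi/N, 1/j^2 is (pi/N)^2 / x^2. The lower bound comes from x cos x <= sin x, that is
    cot^2 x <= 1/x^2, and the upper one from sin x <= x. *)
Lemma cot2_approx m j : (0 < j <= m)%N ->
  0 <= ((j%:R ^+ 2)^-1 - (pi / m.*2.+1%:R) ^+ 2 * cot2 m j : R)
    <= (pi / m.*2.+1%:R) ^+ 2.
Proof.
move=> jm; rewrite cot2_sinV//.
have s0 := @cot2_sin_gt0 R _ _ jm; have /andP[x0 xpi] := @cot2_angle R _ _ jm.
have xE : (j%:R ^+ 2)^-1 =
   (pi / m.*2.+1%:R) ^+ 2 * (j%:R * pi / m.*2.+1%:R) ^- 2 :> R.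
  have j0 : j%:R != 0 :> R by rewrite pnatr_eq0 -lt0n; case/andP: jm.
  have N0 : m.*2.+1%:R != 0 :> R by rewrite pnatr_eq0.
  have p0 : pi != 0 :> R by rewrite gt_eqF ?pi_gt0.
  move: j%:R m.*2.+1%:R pi j0 N0 p0 => a b c a0 b0 c0.
  by field; rewrite a0 b0 c0.
have c0 : 0 < cos (j%:R * pi / m.*2.+1%:R : R).
  apply: cos_gt0_pihalf; rewrite xpi andbT (lt_trans _ x0)// oppr_lt0.
  by rewrite divr_gt0 ?pi_gt0.
have /andP[s1 s2] : (j%:R * pi / m.*2.+1%:R) * cos (j%:R * pi / m.*2.+1%:R)
     <= sin (j%:R * pi / m.*2.+1%:R : R) <= j%:R * pi / m.*2.+1%:R.
  apply: sin_bounds => //; apply: ltW; apply: lt_le_trans xpi _.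
  by have := @pi_gt0 R; lra.
rewrite xE; move: s0 x0 xpi c0 s1 s2 (cos2Dsin2 (j%:R * pi / m.*2.+1%:R : R)).
set x := j%:R * pi / _; set s := sin x; set c := cos x.
move=> s0 x0 xpi c0 s1 s2 cs1.
rewrite -mulrBr mulr_ge0 ?sqr_ge0//=; last first.
  have -> : x ^- 2 - (s ^- 2 - 1) = (s ^+ 2 - (x * c) ^+ 2) / (x ^+ 2 * s ^+ 2).
    have c2 : c ^+ 2 = 1 - s ^+ 2 by rewrite -cs1 addrK.
    have -> : (x * c) ^+ 2 = x ^+ 2 * (1 - s ^+ 2) by rewrite exprMn c2.
    by field; rewrite !gt_eqF.
  apply: divr_ge0; last by rewrite mulr_ge0 ?sqr_ge0.
  have xc0 : 0 <= x * c by rewrite mulr_ge0 ?ltW.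
  by rewrite subr_ge0 !expr2; apply: ler_pM.
rewrite ler_piMr ?sqr_ge0// opprB addrA lerBlDr addrC lerD2l.
rewrite lef_pV2 ?posrE ?exprn_gt0//.
by rewrite lerXn2r// nnegrE ltW.
Qed.

Lemma sum_half_le m : \sum_(k < m) (2^-1 : R) ^+ k <= 2.
Proof.
suff -> : \sum_(k < m) (2^-1 : R) ^+ k = 2 - 2 * 2^-1 ^+ m.
  by rewrite gerBl mulr_ge0// exprn_ge0// invr_ge0.
elim: m => [|m IH]; first by rewrite big_ord0; lra.
by rewrite big_ord_recr /= IH exprS; lra.
Qed.

(** Terms of the series of sinh(sqrt z)/sqrt z. At z = -(pi v)^2 the sum is sin(pi v)/(pi v),
    written without square roots. *)
Definition sinc_term (z : R[i]) (k : nat) : R[i]^o :=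
  ((k.*2.+1)`!%:R^-1 : R)%:C * z ^+ k.

Lemma sinc_cvg z : normc z <= 2^-1 ->
  exists l : R[i]^o, series (sinc_term z) @ \oo --> l.
Proof.
move=> z2; apply: (@cvg_series_normc _ _ (geometric 1 2^-1)).
  move=> n; rewrite /= mul1r normcM normc_real normcX ger0_norm ?invr_ge0//.
  rewrite -[leRHS]mul1r ler_pM ?exprn_ge0 ?normc_ge0 ?invr_ge0//.
    by rewrite invf_le1 ?ltr0n ?fact_gt0// ler1n fact_gt0.
  by rewrite lerXn2r// nnegrE ?normc_ge0// invr_ge0.
by apply: is_cvg_geometric_series; rewrite ger0_norm; lra.
Qed.

(** Since pi <= 4, pi^2 / 32 is at most 1/2; the radius 1/32 is chosen for this. *)
Lemma pi2_normc (w : R[i]) : normc w <= 32^-1 ->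
  normc (- (pi ^+ 2)%:C * w) <= 2^-1.
Proof.
move=> w32; rewrite normcM normcN normc_real ger0_norm ?sqr_ge0//.
have p4 : pi <= 4 :> R by have := @pihalf_lt2 R; lra.
have p16 : pi ^+ 2 <= 16 :> R.
  have -> : 16 = 4 ^+ 2 :> R by rewrite expr2; lra.
  by rewrite lerXn2r// nnegrE ?pi_ge0.
have := ler_pM (sqr_ge0 _) (normc_ge0 w) p16 w32; lra.
Qed.

(** [cot2_product] at w (pi/N)^2, divided by N, turns the product into a sum whose coefficients are
    within 2/N of those of [sinc_term]. As |z| <= 1/2, the errors sum to at most 2/N times 2. *)
Lemma cot2_prod_approx (w : R[i]) m : normc w <= 32^-1 ->
  normc (\prod_(j < m) (1 - w * ((pi / m.*2.+1%:R) ^+ 2 * cot2 m j.+1)%:C)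
         - series (sinc_term (- (pi ^+ 2)%:C * w)) m.+1) <= 4 / m.*2.+1%:R.
Proof.
move=> w32; set z := - _ * w.
have n0 : 0 < m.*2.+1%:R :> R by rewrite ltr0n.
have -> : \prod_(j < m) (1 - w * ((pi / m.*2.+1%:R) ^+ 2 * cot2 m j.+1)%:C) =
    \sum_(k < m.+1)
      ('C(m.*2.+1, k.*2.+1)%:R / m.*2.+1%:R ^+ k.*2.+1)%:C * z ^+ k.
  have [n nE] : {n : R | n = m.*2.+1%:R} by exists m.*2.+1%:R.
  rewrite -nE in n0 *.
  have nC : n%:C != 0 by rewrite fmorph_eq0 gt_eqF.
  have := cot2_product m (w * ((pi / n) ^+ 2)%:C).
  have -> : m.*2.+1%:R = n%:C by rewrite nE rmorph_nat.
  under [in RHS]eq_bigr do rewrite -mulrA -rmorphM.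
  move=> /(congr1 (fun x => n%:C^-1 * x)); rewrite mulKf// => <-.
  rewrite mulr_sumr; apply: eq_bigr => k _.
  have -> : - (w * ((pi / n) ^+ 2)%:C) = z * (n ^+ 2)%:C^-1.
    rewrite /z expr_div_n rmorphM fmorphV /=.
    by move: (pi ^+ 2)%:C ((n ^+ 2)%:C^-1) => a b; ring.
  rewrite exprMn exprVn -rmorphXn -exprM mul2n rmorphM /= fmorphV /=.
  rewrite exprS rmorphM invfM /= rmorph_nat.
  by move: ((n ^+ _)%:C^-1) n%:C^-1 'C(_, _)%:R (z ^+ _) => a b c d; ring.
rewrite /series /= big_mkord -sumrB.
apply: le_trans (normc_sum _ _ _ _) _.
apply: (@le_trans _ _ (\sum_(k < m.+1) (2 / m.*2.+1%:R) * 2^-1 ^+ k)).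
  apply: ler_sum => k _; rewrite -mulrBl -rmorphB normcM normc_real normcX.
  apply: ler_pM => //; [exact: exprn_ge0 (normc_ge0 _)| |].
    by rewrite distrC; exact: bin_approx.
  by rewrite lerXn2r ?nnegrE ?normc_ge0 ?invr_ge0// pi2_normc.
rewrite -mulr_sumr; apply: (@le_trans _ _ (2 / m.*2.+1%:R * 2)).
  by rewrite ler_wpM2l ?sum_half_le// divr_ge0// ltW.
by rewrite mulrAC -natrM.
Qed.

Lemma cvg_odd_inv (a : R) :
  a / m.*2.+1%:R @[m --> \oo] --> (0 : R).
Proof.
rewrite -(mulr0 a); apply: cvgM; first exact: cvg_cst.
apply: (squeeze_cvgr _ (cvg_cst 0) (@cvg_harmonic R)).
apply: nearW => m; rewrite invr_ge0 ler0n /= lef_pV2 ?posrE ?ltr0n// ler_nat.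
by rewrite ltnS -addnn leq_addr.
Qed.

(** The cotangent product [Q] lies between: it is close to [P] factor by factor ([cot2_approx],
    [prod_dist]) and close to the partial sum of the series ([cot2_prod_approx]). *)
Lemma euler_product (w : R[i]) (l : R[i]^o) : normc w <= 32^-1 ->
  series (sinc_term (- (pi ^+ 2)%:C * w)) @ \oo --> l ->
  (\prod_(j < m) (1 - w * ((j.+1%:R ^+ 2)^-1)%:C) : R[i]^o) @[m --> \oo] --> l.
Proof.
move=> w32 hl; have w1 : normc w <= 1 by lra.
have hl1 : series (sinc_term (- (pi ^+ 2)%:C * w)) m.+1 @[m --> \oo] --> l.
  by rewrite cvg_shiftS.
have /cvg_normc hl1n := hl1.
pose S := series (sinc_term (- (pi ^+ 2)%:C * w)).
(* The summands bound [P - Q], [Q - S m.+1] and [S m.+1 - l]. The index is [m.+1] because a product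
   of m factors has m+1 coefficients. *)
pose v (m : nat) :=
  4 * pi ^+ 2 / m.*2.+1%:R + 4 / m.*2.+1%:R + normc (S m.+1 - l).
refine (@normc_squeeze _ _ _ v _ _) => [m|]; last first.
  rewrite -[0](addr0 (0 : R)); apply: cvgD => //.
  by rewrite -[0](addr0 (0 : R)); apply: cvgD; exact: cvg_odd_inv.
set P := \prod_(j < m) _.
set Q := \prod_(j < m) (1 - w * ((pi / m.*2.+1%:R) ^+ 2 * cot2 m j.+1)%:C).
have -> : P - l = (P - Q) + (Q - S m.+1) + (S m.+1 - l) by ring.
apply: le_trans (le_normcD _ _) _; apply: lerD => //.
apply: le_trans (le_normcD _ _) _; apply: lerD; last exact: cot2_prod_approx.
pose x j := 1 - w * ((j.+1%:R ^+ 2)^-1 : R)%:C.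
pose y j := 1 - w * ((pi / m.*2.+1%:R) ^+ 2 * cot2 m j.+1)%:C.
have := @prod_dist x y (fun j => 1 + (j.+1%:R ^+ 2)^-1) m.
have invsq_ge0 j : 0 <= (j.+1%:R ^+ 2)^-1 :> R by rewrite invr_ge0 sqr_ge0.
have nb (a : R) j : `|a| <= (j.+1%:R ^+ 2)^-1 ->
    normc (1 - w * a%:C) <= 1 + (j.+1%:R ^+ 2)^-1.
  move=> ha; apply: le_trans (le_normcD _ _) _; rewrite normc1 lerD2l normcN.
  by rewrite normcM normc_real -[leRHS]mul1r ler_pM ?normc_ge0.
move=> /(_ _)/le_trans; apply.
  move=> j jm; split; first by rewrite lerDl.
  have jm' : (0 < j.+1 <= m)%N by [].
  have /andP[h1 h2] := cot2_approx _ _ jm'.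
  split; apply: nb; first by rewrite ger0_norm.
  rewrite ger0_norm; first by rewrite -subr_ge0.
  by apply: mulr_ge0; exact: sqr_ge0.
have n0 : 0 < m.*2.+1%:R :> R by rewrite ltr0n.
(* The 4 bounds the product of the majorants 1 + 1/j^2, and each pair of factors differs by at most
   |w| (pi/N)^2 <= (pi/N)^2. *)
apply: (@le_trans _ _ (4 * \sum_(j < m) (pi / m.*2.+1%:R) ^+ 2)).
  apply: ler_pM; [| |exact: prodD_invsq_le4|].
  - by apply: prodr_ge0 => j _; rewrite addr_ge0.
  - by apply: sumr_ge0 => j _; exact: normc_ge0.
  apply: ler_sum => j _; rewrite /x /y.
  have jm' : (0 < j.+1 <= m)%N by exact: ltn_ord.
  have /andP[h1 h2] := cot2_approx _ _ jm'.
  rewrite opprB addrC addrA subrK -mulrBr -rmorphB normcM normc_real.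
  rewrite distrC ger0_norm// -[leRHS]mul1r ler_pM ?normc_ge0//.
rewrite sumr_const card_ord -[_ *+ m]mulr_natr.
have mN : m%:R / m.*2.+1%:R <= 1 :> R.
  by rewrite ler_pdivrMr// mul1r ler_nat -addnn -addSn leq_addl.
rewrite (_ : _ ^+ 2 * m%:R = pi ^+ 2 / m.*2.+1%:R * (m%:R / m.*2.+1%:R)).
  by rewrite -[leRHS]mulrA ler_pM2l// ler_piMr// divr_ge0 ?sqr_ge0 ?ltW.
by move: m.*2.+1%:R m%:R n0 {mN} => a b a0; field; rewrite gt_eqF.
Qed.

(** Telescoping: 1/(x+1)^2 <= 1/x - 1/(x+1). *)
Lemma sum_invsq_le2 m : \sum_(j < m) (j.+1%:R ^+ 2)^-1 <= 2 :> R.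
Proof.
case: m => [|m]; first by rewrite big_ord0.
suff : \sum_(j < m.+1) (j.+1%:R ^+ 2)^-1 <= 2 - m.+1%:R^-1 :> R.
  by move=> /le_trans; apply; rewrite gerBl.
elim: m => [|m IH]; first by rewrite big_ord1 expr1n invr1; lra.
rewrite big_ord_recr /=; apply: le_trans (lerD IH (lexx _)) _.
rewrite -addrA lerD2l -lerBrDl opprK addrC.
have : 0 < m.+1%:R :> R by rewrite ltr0n.
rewrite -(natr1 m.+1); move: m.+1%:R => x x0.
have x1 : 0 < x + 1 by lra.
rewrite -subr_ge0.
have -> : x^-1 - (x + 1)^-1 - (x + 1) ^- 2 = (x * (x + 1) ^+ 2)^-1.
  by field; rewrite !gt_eqF.
by rewrite invr_ge0 mulr_ge0 ?sqr_ge0// ltW.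
Qed.

(** Weierstrass's inequality: the product is at least 1 - |w| times the sum of the 1/j^2, hence at
    least 1 - 2/32. It keeps the limit of the denominators away from 0. *)
Lemma prod_lower (w : R[i]) m : normc w <= 32^-1 ->
  2^-1 <= normc (\prod_(j < m) (1 - w * ((j.+1%:R ^+ 2)^-1)%:C)).
Proof.
move=> w32; rewrite normc_prod.
suff h : 1 - normc w * \sum_(j < m) (j.+1%:R ^+ 2)^-1 <=
    \prod_(j < m) normc (1 - w * ((j.+1%:R ^+ 2)^-1)%:C).
  apply: le_trans h; have := ler_pM (normc_ge0 w) _ w32 (sum_invsq_le2 m).
  rewrite sumr_ge0 => [|i _]; last by rewrite invr_ge0 sqr_ge0.
  by move=> /(_ isT); lra.
elim: m => [|m IH]; first by rewrite !big_ord0; lra.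
rewrite !big_ord_recr /=.
set S := \sum_(j < m) _ in IH *; set P := \prod_(j < m) _ in IH *.
have S0 : 0 <= S by apply: sumr_ge0 => j _; rewrite invr_ge0 sqr_ge0.
set q : R := (m.+1%:R ^+ 2)^-1.
have q0 : 0 <= q by rewrite invr_ge0 sqr_ge0.
have q1 : q <= 1 by rewrite invf_le1 ?exprn_gt0// exprn_ege1// ler1n.
have h : 1 - normc w * q <= normc (1 - w * q%:C).
  have := le_normcD (1 - w * q%:C) (w * q%:C).
  by rewrite subrK normc1 normcM normc_real ger0_norm//; lra.
have w0 := normc_ge0 w.
have wq : normc w * q <= 1 by apply: le_trans (ler_pM w0 q0 w32 q1) _; lra.
apply: (@le_trans _ _ (P * (1 - normc w * q))); last first.
  by rewrite ler_wpM2l// prodr_ge0// => j _; exact: normc_ge0.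
apply: (@le_trans _ _ ((1 - normc w * S) * (1 - normc w * q))); last first.
  by rewrite ler_wpM2r// subr_ge0.
have : 0 <= (normc w * S) * (normc w * q) by rewrite !mulr_ge0.
by lra.
Qed.

(** The even terms of the sine series vanish, and the term of index 2k+1 is pi v times [sinc_term]
    of index k. Either square root of [w] may serve as [v]. *)
Lemma csin_sinc (v w : R[i]) (l : R[i]^o) : v ^+ 2 = w ->
  series (sinc_term (- (pi ^+ 2)%:C * w)) @ \oo --> l ->
  csin ((pi : R)%:C * v) = (pi : R)%:C * v * l.
Proof.
move=> vw hl; rewrite /csin.
set u : nat -> R[i]^o := fun n => _.
pose S := series (sinc_term (- (pi ^+ 2)%:C * w)).
suff : series u @ \oo --> ((pi : R)%:C * v * l : R[i]^o).
  by move=> H; rewrite (cvg_lim (@norm_hausdorff R[i] R[i]^o) H).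
(* Among the indices below [n] exactly [n./2] are odd. *)
have uE n : series u n = (pi : R)%:C * v * S n./2.
  have ev k : u k.*2 = 0 by rewrite /u sin_coeff_even mul0r.
  have od k : u k.*2.+1 = (pi : R)%:C * v * sinc_term (- (pi ^+ 2)%:C * w) k.
    rewrite /u /sinc_term /sin_coeff /= odd_double /= doubleK expr1n mulr1 mul1r.
    have E : ((pi : R)%:C * v) ^+ k.*2 = ((pi ^+ 2)%:C * w) ^+ k.
      by rewrite -mul2n exprM; congr (_ ^+ k); rewrite rmorphXn -vw -exprMn.
    rewrite exprS E mulNr (exprNn (_ * w)) rmorphM rmorphXn rmorphN rmorph1 /=.
    by move: (_ ^+ k) (_ ^+ k) (_%:C) (pi%:C) => a b c d; ring.
  have h k : series u k.*2 = (pi : R)%:C * v * S k.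
    rewrite /S /series /= !big_mkord sum_double mulr_sumr.
    by apply: eq_bigr => i _; rewrite ev od add0r.
  rewrite -{1}(odd_double_half n).
  case: (odd n) => /=; rewrite ?add0n ?add1n ?h//.
  by rewrite seriesSr ?h ev addr0.
rewrite (_ : series u = fun n => (pi : R)%:C * v * S n./2 : R[i]^o);
  last exact/funext.
apply: cvgM; first exact: cvg_cst.
have half_cvg : n./2 @[n --> \oo] --> \oo.
  apply/cvgnyPge => A; exists A.*2 => // n /=; rewrite -{2}(doubleK A).
  exact: half_leq.
have := cvg_comp _ _ half_cvg hl; exact.
Qed.
End EulerProduct.

(** * Truncated zeta values, their limits, and the coefficients of the finite products *)

Section TruncatedZeta.
Context {R : realType}.
Local Open Scope classical_set_scope.

(* The sum defining [mzeta], restricted to n_1 <= M. *)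
Fixpoint tzeta (M : nat) (i : seq nat) : R :=
  match M, i with
  | _, [::] => 1
  | 0, _ => 0
  | M'.+1, a :: i' => tzeta M' i + M'.+1%:R ^- a * tzeta M' i'
  end.

Lemma tzeta_nil M : tzeta M [::] = 1.
Proof. by case: M. Qed.

Lemma tzeta_ge0 M i : 0 <= tzeta M i.
Proof.
elim: M i => [|M IH] [|a i] //=; rewrite addr_ge0// mulr_ge0//.
Qed.

Lemma tzeta_nondecreasing i : nondecreasing_seq (tzeta^~ i).
Proof.
apply/nondecreasing_seqP => M; case: i => [|a i]; first by rewrite !tzeta_nil.
by rewrite /= lerDl mulr_ge0 ?tzeta_ge0// invr_ge0 exprn_ge0.
Qed.

(** With exponents at least 2, the truncated sum is dominated by part of the expansion of the power.
    In the induction, h^(k+1) + q h^k = (h+q) h^k <= (h+q)^(k+1). *)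
Lemma tzeta_bound M i : all (leq 2) i ->
  tzeta M i <= (\sum_(j < M) (j.+1%:R ^+ 2)^-1) ^+ size i.
Proof.
elim: M i => [|M IH] [|a i] //= /andP[a2 i2].
  by rewrite big_ord0 exprS mul0r.
rewrite big_ord_recr /=; have /= h1 := IH (a :: i); have h2 := IH _ i2.
set h := \sum_(j < M) _ in h1 h2 *; set q := (M.+1%:R ^+ 2)^-1.
have h0 : 0 <= h by apply: sumr_ge0 => j _; rewrite invr_ge0 exprn_ge0.
have q0 : 0 <= q by rewrite invr_ge0 exprn_ge0.
have aq : M.+1%:R ^- a <= q.
  rewrite /q lef_pV2 ?posrE ?exprn_gt0// ler_weXn2l// ler1n//.
apply: (@le_trans _ _ ((h + q) * h ^+ size i)).
  rewrite mulrDl -exprS lerD// ?h1 ?a2//.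
  by apply: ler_pM => //; rewrite ?tzeta_ge0 ?invr_ge0 ?exprn_ge0.
rewrite exprS ler_wpM2l ?addr_ge0// lerXn2r// ?nnegrE ?addr_ge0// lerDl//.
Qed.

Lemma tzeta_cvg i : all (leq 2) i -> cvgn (tzeta^~ i).
Proof.
move=> i2; apply: nondecreasing_is_cvgn; first exact: tzeta_nondecreasing.
exists (2 ^+ size i) => _ [M _ <-]; apply: le_trans (tzeta_bound M i i2) _.
apply: lerXn2r; rewrite ?nnegrE//; last exact: sum_invsq_le2.
by apply: sumr_ge0 => j _; rewrite invr_ge0 exprn_ge0.
Qed.

Definition decr_tuples M k : set (k.-tuple nat) :=
  [set n | sorted gtn n /\ all (fun m => (0 < m <= M)%N) n].

Definition mzeta_term k (i n : k.-tuple nat) : R :=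
  \prod_(j < k) ((tnth n j)%:R ^- tnth i j).

Lemma mzeta_term_ge0 k (i n : k.-tuple nat) : 0 <= mzeta_term k i n.
Proof. by apply: prodr_ge0 => j _; rewrite invr_ge0 exprn_ge0. Qed.

Lemma le_esumZ (T : choiceType) (S : set T) (a : T -> \bar R) (c : R) :
  0 <= c -> (forall x, 0 <= a x)%E ->
  (\esum_(x in S) (c%:E * a x) <= c%:E * \esum_(x in S) a x)%E.
Proof.
move=> c0 a0; apply: ge_ereal_sup => _ [X XS <-].
rewrite -ge0_mule_fsumr//; apply: lee_wpmul2l; first by rewrite lee_fin.
by apply: esum_ge; exists X.
Qed.

(** The reverse inequality is [le_esumZ] for the family [c%:E * a x] and the factor [c^-1]. *)
Lemma esumZ (T : choiceType) (S : set T) (a : T -> \bar R) (c : R) :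
  0 < c -> (forall x, 0 <= a x)%E ->
  \esum_(x in S) (c%:E * a x)%E = (c%:E * \esum_(x in S) a x)%E.
Proof.
move=> c0 a0; apply/eqP; rewrite eq_le; apply/andP; split.
  exact: le_esumZ (ltW c0) a0.
have ca0 x : (0 <= c%:E * a x)%E by rewrite mule_ge0// lee_fin ltW.
have := @le_esumZ T S (fun x => c%:E * a x)%E c^-1; rewrite invr_ge0 (ltW c0).
move=> /(_ isT ca0) h.
have e x : (c^-1%:E * (c%:E * a x) = a x)%E.
  by rewrite muleA -EFinM mulVf ?gt_eqF// mul1e.
have {}h : (\esum_(x in S) a x <= c^-1%:E * \esum_(x in S) (c%:E * a x))%E.
  by apply: le_trans h; apply: le_esum => x _; rewrite e.
have := @lee_wpmul2l R c%:E _ _ _ h; rewrite lee_fin (ltW c0) => /(_ isT).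
by rewrite muleA -EFinM mulfV ?gt_eqF// mul1e.
Qed.

(** The head is the largest entry, so it equals M+1 when the bound [M] fails, and strict decrease
    bounds the rest by [M]. This is the recursion of [tzeta] at the level of index sets. *)
Lemma decr_tuplesS M k :
  decr_tuples M.+1 k.+1 `&` ~` decr_tuples M k.+1 =
  [set [tuple of M.+1 :: n] | n in decr_tuples M k].
Proof.
apply/seteqP; split => [n [[sn an] nn]|_ [n [sn an] <-]] /=.
  case/tupleP: n sn an nn => a n /= sn /andP[/andP[a0 aM] an] nn.
  have gtn_trans : transitive gtn.
    by move=> x y z /= xy yz; exact: ltn_trans yz xy.
  have agt : all (gtn a) n by exact: order_path_min sn.
  have aE : a = M.+1.
    apply/eqP; rewrite eqn_leq aM /= ltnNge; apply/negP => aleM; apply: nn.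
    split => //=; rewrite a0 aleM /=; apply/allP => x xn.
    move/allP: an => /(_ _ xn)/andP[-> _].
    by move/allP: agt => /(_ _ xn) /= /ltnW/leq_trans; apply.
  exists n; last by apply: val_inj; rewrite /= aE.
  split; first exact: path_sorted sn.
  apply/allP => x xn; move/allP: an => /(_ _ xn)/andP[-> _].
  by move/allP: agt => /(_ _ xn) /=; rewrite aE ltnS.
split.
  split; last first.
    rewrite /= leqnn /=; apply: sub_all an => x /andP[-> xM]; exact: leqW.
  rewrite /= path_min_sorted//; apply: sub_all an => x /andP[_ xM] /=.
  by rewrite ltnS.
by case=> _ /= ; rewrite ltnn.
Qed.

Lemma mzeta_termS k a (i n : k.-tuple nat) m :
  mzeta_term k.+1 [tuple of a :: i] [tuple of m :: n] =
  m%:R ^- a * mzeta_term k i n.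
Proof.
rewrite /mzeta_term big_ord_recl !tnth0; congr (_ * _).
by apply: eq_bigr => j _; rewrite !tnthS.
Qed.

Lemma esum_decr_tuples M k (i : k.-tuple nat) :
  \esum_(n in decr_tuples M k) (mzeta_term k i n)%:E = (tzeta M i)%:E.
Proof.
have nilE M' (i' : 0.-tuple nat) :
    \esum_(n in decr_tuples M' 0) (mzeta_term 0 i' n)%:E = (tzeta M' i')%:E.
  rewrite (tuple0 i') /= tzeta_nil.
  rewrite (_ : decr_tuples M' 0 = [set [tuple]]); last first.
    by apply/seteqP; split => n /=; rewrite (tuple0 n).
  by rewrite esum_set1 ?lee_fin ?mzeta_term_ge0// /mzeta_term big_ord0.
elim: M k i => [|M IH] [|k] i; rewrite ?nilE//.
  rewrite (_ : decr_tuples 0 k.+1 = set0) ?esum_set0.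
    by case/tupleP: i => a i.
  apply/seteqP; split => n //= -[_]; case/tupleP: n => a n /=.
  by case: a.
rewrite (@esumID _ _ (decr_tuples M k.+1)); last first.
  by move=> n _; rewrite lee_fin mzeta_term_ge0.
rewrite decr_tuplesS esum_image; last first.
  by move=> m n _ _ /(congr1 val) /= [] /val_inj.
rewrite (_ : _ `&` _ = decr_tuples M k.+1); last first.
  apply/seteqP; split => [n []//|n [sn an]]; split; last by split.
  by split => //; apply: sub_all an => x /andP[-> /leqW].
rewrite IH; case/tupleP: i => a i.
under eq_esum do rewrite mzeta_termS EFinM.
rewrite esumZ; [by rewrite IH|by rewrite invr_gt0 exprn_gt0|].
by move=> n; rewrite lee_fin mzeta_term_ge0.
Qed.

(** A finite set of index tuples lies in some [decr_tuples M k], so the unordered sum is the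
    supremum of the increasing sequence [tzeta M i]. *)
Lemma tzeta_cvg_mzeta k (i : k.-tuple nat) : all (leq 2) i ->
  tzeta M i @[M --> \oo] --> mzeta R i.
Proof.
move=> i2; have ci := tzeta_cvg _ i2.
suff -> : mzeta R i = limn (tzeta^~ i) by [].
rewrite /mzeta -/(mzeta_term k i).
set S := [set n : k.-tuple nat | _].
have SE : S = \bigcup_M decr_tuples M k.
  apply/seteqP; split => [n [sn an]|n [M _ [sn an]]]; last first.
    by split => //; apply: sub_all an => x /andP[].
  exists (\max_(m <- n) m)%N => //; split => //; apply/allP => x xn.
  by rewrite (allP an _ xn) /=; exact: (leq_bigmax_seq (F := id)).
(* The sum is shown to be a real number, so [fine] does not take its default value. *)
suff -> : \esum_(n in S) (mzeta_term k i n)%:E = (limn (tzeta^~ i))%:E by [].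
apply/eqP; rewrite eq_le; apply/andP; split.
  apply: ge_ereal_sup => _ [X [finX XS] <-].
  have [M XM] : exists M, X `<=` decr_tuples M k.
    move/finite_fsetP: finX => [F FE].
    exists (\max_(n <- finmap.enum_fset F) \max_(m <- n) m)%N => n Xn.
    have [sn an] := XS _ Xn; split => //; apply/allP => x xn.
    rewrite (allP an _ xn) /=.
    apply: leq_trans (leq_bigmax_seq (F := id) x xn isT) _.
    have nF : n \in finmap.enum_fset F by move: Xn; rewrite FE.
    pose f (n : k.-tuple nat) := (\max_(m <- n) m)%N.
    exact: (leq_bigmax_seq (F := f) n nF isT).
  apply: (@le_trans _ _ (tzeta M i)%:E).
    by rewrite -esum_decr_tuples; apply: esum_ge; exists X.
  rewrite lee_fin; apply: nondecreasing_cvgn_le => //.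
  exact: tzeta_nondecreasing.
have tle M : ((tzeta M i)%:E <= \esum_(n in S) (mzeta_term k i n)%:E)%E.
  rewrite -esum_decr_tuples; apply: ge_ereal_sup => _ [X [finX XM] <-].
  apply: esum_ge; exists X => //; split => // n /XM Mn.
  by rewrite SE; exists M.
case E : (\esum_(n in S) _) tle => [e| |] tle; rewrite ?leey//.
  rewrite lee_fin; apply: limr_le => //.
  by apply: nearW => M; rewrite -lee_fin tle.
by have := tle 0%N; rewrite leNgt ltNye.
Qed.

(* The coefficient of t^n s^k in the product over 1 <= j <= M of
   1 + s (t/j^2) / (1 - t/j^2). *)
Fixpoint pcoef (M n k : nat) : R :=
  match M with
  | 0 => ((n == 0) && (k == 0))%N%:R
  | M'.+1 => pcoef M' n k +
      (if k is k'.+1 then \sum_(l < n) M'.+1%:R ^- (n - l).*2 * pcoef M' l k'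
       else 0)
  end.

Lemma sum_tupleS (V : nmodType) (T : finType) k (P : pred (k.+1.-tuple T))
    (F : k.+1.-tuple T -> V) :
  \sum_(i | P i) F i =
  \sum_(a : T) \sum_(i : k.-tuple T | P [tuple of a :: i]) F [tuple of a :: i].
Proof.
rewrite pair_big_dep /=.
rewrite (reindex (fun p : T * k.-tuple T => [tuple of p.1 :: p.2])) //=.
exists (fun i : k.+1.-tuple T => (thead i, [tuple of behead i])) =>
    [[a i]|i] _ /=.
  by congr pair; apply: val_inj.
by rewrite -tuple_eta.
Qed.

Lemma sum_tuple0 (V : nmodType) (T : finType) (P : pred (0.-tuple T))
    (F : 0.-tuple T -> V) :
  \sum_(i | P i) F i = if P [tuple] then F [tuple] else 0.
Proof.
by rewrite big_mkcond (big_pred1 [tuple]) // => i; apply/esym/eqP/tuple0.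
Qed.

(** The bound [B] on the entries is separate from the weight [N], since removing the first entry
    lowers the weight while the type of the entries stays. *)
Definition even_index B N k (i : k.-tuple 'I_B.+1) :=
  all (fun m : 'I_B.+1 => (0 < m)%N && ~~ odd m) i
  && (\sum_(j < k) (tnth i j : nat) == N)%N.

Lemma even_indexS B N k (a : 'I_B.+1) (i : k.-tuple 'I_B.+1) :
  even_index B N k.+1 [tuple of a :: i] =
  [&& (0 < a)%N, ~~ odd a, (a <= N)%N & even_index B (N - a)%N k i].
Proof.
rewrite /even_index big_ord_recl tnth0 /=.
under eq_bigr do rewrite tnthS.
set s := (\sum_(j < k) _)%N; case: (0 < a)%N => //=; case: (odd a) => //=.
case: (all _ _); rewrite /= ?andbF//.
by apply/eqP/andP => [<-|[aN /eqP ->]]; [rewrite leq_addr addKn|rewrite subnKC].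
Qed.

(** Induction on [M], with the sum split by the first exponent a. The second term of the recursion
    of [tzeta] leaves weight 2n - a, and a = 2(n-l) gives the summand of index l in [pcoef]. *)
Lemma pcoefE B n k M : (n.*2 <= B)%N ->
  \sum_(i : k.-tuple 'I_B.+1 | even_index B n.*2 k i)
     tzeta M (map_tuple (@nat_of_ord B.+1) i) = pcoef M n k.
Proof.
elim: M n k => [|M IH] n [|k] nB.
- rewrite sum_tuple0 /even_index big_ord0 /= eq_sym double_eq0 andbT.
  by case: eqP.
- by rewrite big1 /= ?andbF// => i _; case/tupleP: i.
- by rewrite /= addr0 -IH// !sum_tuple0 /= tzeta_nil.
have tE (a : 'I_B.+1) (i : k.-tuple 'I_B.+1) :
    tzeta M.+1 (map_tuple (@nat_of_ord B.+1) [tuple of a :: i]) =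
    tzeta M (map_tuple (@nat_of_ord B.+1) [tuple of a :: i]) +
    M.+1%:R ^- a * tzeta M (map_tuple (@nat_of_ord B.+1) i) by [].
have -> : pcoef M.+1 n k.+1 = pcoef M n k.+1 +
    \sum_(l < n) M.+1%:R ^- (n - l).*2 * pcoef M l k by [].
rewrite -IH// sum_tupleS [in RHS]sum_tupleS.
under eq_bigr do (under eq_bigr do rewrite tE; rewrite big_split /=).
rewrite big_split /=; congr (_ + _).
pose G a := if [&& (0 < a)%N, ~~ odd a & (a <= n.*2)%N]
  then M.+1%:R ^- a * pcoef M (n - a./2) k else 0.
transitivity (\sum_(a < B.+1) G a).
  apply: eq_bigr => a _; rewrite -mulr_sumr.
  rewrite (eq_bigl _ _ (even_indexS _ _ _ _)) /G.
  case: (0 < a)%N; rewrite /= ?big_pred0_eq ?mulr0//.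
  case: (boolP (odd a)) => /= oa; rewrite ?big_pred0_eq ?mulr0//.
  case: (leqP a n.*2) => /= an; rewrite ?big_pred0_eq ?mulr0//.
  have aE : ((n - a./2).*2 = n.*2 - a)%N by rewrite doubleB even_halfK.
  by rewrite -aE IH// aE (leq_trans (leq_subr _ _)).
have GE : \sum_(a < n.*2.+1) G a = \sum_(a < B.+1) G a.
  rewrite (big_ord_widen B.+1 G) // big_mkcond /=; apply: eq_bigr => a _.
  by rewrite /G ltnS; case: (a <= n.*2)%N; rewrite ?andbF.
(* The added index 2n+1 is odd, so [G] vanishes there, and the range now splits into pairs of an
   even and an odd index. *)
have G1 : \sum_(a < n.*2.+1) G a = \sum_(a < n.+1.*2) G a.
  by rewrite doubleS [RHS]big_ord_recr /= /G /= odd_double /= addr0.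
rewrite -GE G1 sum_double big_ord_recl /= {1 2}/G /= !add0r.
(* With a = 0 removed, the exponents 2, 4, ..., 2n are reversed to match 2(n-l) for l < n. *)
rewrite (reindex_inj rev_ord_inj) /=; apply: eq_bigr => l _.
have ln := ltn_ord l.
have -> : (bump 0 (n - l.+1) = n - l)%N by rewrite /bump /= add1n subnSK.
rewrite /G /= odd_double /= addr0 double_gt0 subn_gt0 ln /= leq_double leq_subr.
by rewrite doubleK subKn// ltnW.
Qed.

Lemma pcoef_eq0 M n k : (n < k)%N -> pcoef M n k = 0.
Proof.
elim: M n k => [|M IH] n [|k]//= nk; first by rewrite andbF.
rewrite IH// add0r big1// => l _; rewrite IH ?mulr0//.
exact: leq_trans (ltn_ord l) _.
Qed.

Lemma pcoefn0 M n : pcoef M n 0 = (n == 0)%N%:R.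
Proof. by elim: M => [|M IH] /=; rewrite ?andbT// IH addr0. Qed.

Lemma pcoef_ge0 M n k : 0 <= pcoef M n k.
Proof.
elim: M n k => [|M IH] n k //=; apply: addr_ge0 => //; case: k => // k.
by apply: sumr_ge0 => l _; rewrite mulr_ge0// invr_ge0 exprn_ge0.
Qed.

Lemma cvg_sum (K : numFieldType) (V : normedModType K) (I : Type) (r : seq I)
    (P : pred I) (f : I -> nat -> V) (a : I -> V) :
  (forall i, P i -> f i @ \oo --> a i) ->
  \sum_(i <- r | P i) f i M @[M --> \oo] --> \sum_(i <- r | P i) a i.
Proof.
move=> h; elim: r => [|i r IH].
  by rewrite big_nil; under eq_fun do rewrite big_nil; exact: cvg_cst.
rewrite big_cons; under eq_fun do rewrite big_cons.
by case: ifP => // Pi; apply: cvgD => //; exact: h.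
Qed.

Lemma pcoef_cvg n k : pcoef M n k @[M --> \oo] --> F_coef R n k.
Proof.
rewrite /F_coef; case: k => [|k].
  rewrite andbT /=; under eq_fun do rewrite pcoefn0.
  by case: eqP => _; exact: cvg_cst.
rewrite andbF /=; case: ltnP => [kn|nk]; last first.
  by under eq_fun do rewrite pcoef_eq0//; exact: cvg_cst.
under eq_fun do rewrite -(@pcoefE n.*2)//.
apply: (@cvg_sum R R^o) => i /andP[ei _]; apply: tzeta_cvg_mzeta.
(* A positive even exponent is at least 2, as [tzeta_cvg_mzeta] requires. *)
rewrite all_map; apply: sub_all ei => m /=.
by case: (nat_of_ord m) => [|[|]].
Qed.
End TruncatedZeta.

(** * The finite products as power series, with bounds uniform in [M] *)

Section GeneratingFunction.
Context {R : realType}.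
Local Open Scope classical_set_scope.
Implicit Types s t : R[i].

(** The coefficient of t^n in the M-th product, a polynomial in s; by [pcoef_eq0] its degree is at
    most n. *)
Definition prow M n s : R[i] := \sum_(k < n.+1) (pcoef M n k : R)%:C * s ^+ k.

Lemma prow_widen M n s N : (n < N)%N ->
  \sum_(k < N) (pcoef M n k : R)%:C * s ^+ k = prow M n s.
Proof.
move=> nN; rewrite /prow.
rewrite (big_ord_widen N (fun k => (pcoef M n k : R)%:C * s ^+ k) nN).
rewrite [RHS]big_mkcond; apply: eq_bigr => k _; case: ltnP => // kn.
by rewrite pcoef_eq0 // mul0r.
Qed.

Lemma prow0 M s : prow M 0 s = 1.
Proof. by rewrite /prow big_ord1 pcoefn0 mulr1. Qed.

(** This is multiplication by 1 + s (qt + (qt)^2 + ...), q = 1/(M+1)^2, read off at t^n. *)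
Lemma prowS M n s : prow M.+1 n s =
  prow M n s + s * \sum_(l < n) (M.+1%:R ^- (n - l).*2 : R)%:C * prow M l s.
Proof.
rewrite /prow; under eq_bigr do rewrite /= rmorphD mulrDl.
rewrite big_split /=; congr (_ + _); rewrite big_ord_recl /= mul0r add0r.
under eq_bigr do rewrite /bump /= add0n rmorph_sum mulr_suml.
rewrite exchange_big /= mulr_sumr; apply: eq_bigr => l _.
rewrite -/(prow M l s) -(prow_widen M l s n)// !mulr_sumr.
apply: eq_bigr => k _.
move: (M.+1%:R ^- _) (pcoef M l k) => a b; rewrite rmorphM exprS /=.
by move: a%:C b%:C (s ^+ k) => c d x; ring.
Qed.

Definition qsq M : R := (M.+1%:R ^+ 2)^-1.

Lemma qsq_ge0 M : 0 <= qsq M.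
Proof. by rewrite invr_ge0 sqr_ge0. Qed.

Lemma qsq_le1 M : qsq M <= 1.
Proof. by rewrite invf_le1 ?exprn_gt0// exprn_ege1// ler1n. Qed.

Lemma qsqX M n : M.+1%:R ^- n.*2 = qsq M ^+ n.
Proof. by rewrite -mul2n exprM exprVn. Qed.

Lemma invX_subSn M n l : (l <= n)%N ->
  M.+1%:R ^- (n.+1 - l).*2 = qsq M * M.+1%:R ^- (n - l).*2.
Proof. by move=> ln; rewrite subSn// 2!qsqX -exprS. Qed.

(** A new factor adds at most the sum over l < n of q^(n-l) K 2^l, which is at most q K 2^n because
    q <= 1; so K grows to K (1+q). *)
Lemma prow_le M n s : normc s <= 1 ->
  normc (prow M n s) <= (\prod_(j < M) (1 + qsq j)) * 2 ^+ n.
Proof.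
move=> s1; elim: M n => [|M IH] n.
  rewrite big_ord0 mul1r /prow big_ord_recl /= andbT big1 => [|k _].
    rewrite addr0 mulr1 normc_real ger0_norm// (le_trans (_ : _ <= 1))//.
      by case: eqP.
    by rewrite exprn_ege1// ler1n.
  by rewrite andbF mul0r.
rewrite prowS big_ord_recr /=; set K := \prod_(j < M) _ in IH *.
have K0 : 0 <= K by apply: prodr_ge0 => j _; rewrite addr_ge0// qsq_ge0.
rewrite mulrDr mulr1 mulrDl; apply: le_trans (le_normcD _ _) (lerD (IH n) _).
rewrite normcM -[leRHS]mul1r; apply: ler_pM; rewrite ?normc_ge0//.
apply: le_trans (normc_sum _ _ _ _) _.
apply: (@le_trans _ _ (\sum_(l < n) qsq M * (K * 2 ^+ l))).
  apply: ler_sum => l _; rewrite normcM normc_real qsqX.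
  rewrite ger0_norm ?exprn_ge0 ?qsq_ge0//; apply: ler_pM => //.
  - by rewrite exprn_ge0// qsq_ge0.
  - exact: normc_ge0.
  - rewrite -[leRHS]expr1; apply: ler_wiXn2l; rewrite ?qsq_ge0 ?qsq_le1//.
    by rewrite subn_gt0.
rewrite -!mulr_sumr mulrA (mulrC K); apply: ler_wpM2l.
  by rewrite mulr_ge0// qsq_ge0.
elim: n {IH} => [|n IHn]; first by rewrite big_ord0 exprn_ge0.
by rewrite big_ord_recr /= exprS mulr2n mulrDl mul1r lerD.
Qed.

Lemma prow_bound M n s : normc s <= 1 -> normc (prow M n s) <= 4 * 2 ^+ n.
Proof.
move=> s1; apply: le_trans (prow_le M n s s1) _.
by apply: ler_wpM2r; [exact: exprn_ge0|exact: prodD_invsq_le4].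
Qed.

(** Clearing the denominator 1 - qt of the new factor leaves the numerator 1 - (1-s)qt on the other
    side; the coefficients of t^(n+1) are compared. *)
Lemma prow_rec M n s :
  prow M.+1 n.+1 s - (qsq M)%:C * prow M.+1 n s =
  prow M n.+1 s - (qsq M)%:C * (1 - s) * prow M n s.
Proof.
rewrite !prowS big_ord_recr /= subSnn qsqX expr1.
set A := \sum_(l < n) _; set B := \sum_(l < n) _.
have -> : A = (qsq M)%:C * B.
  rewrite mulr_sumr; apply: eq_bigr => l _.
  by rewrite invX_subSn 1?ltnW// rmorphM -mulrA.
by move: (prow M n.+1 s) (prow M n s) (qsq M)%:C => a b c; ring.
Qed.

Definition psum M N t s : R[i]^o := \sum_(n < N) prow M n s * t ^+ n.

Lemma psum_square M N t s :
  psum M N t s =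
  \sum_(n < N) \sum_(k < N) (pcoef M n k : R)%:C * t ^+ n * s ^+ k.
Proof.
apply: eq_bigr => n _; rewrite -(prow_widen M n s N (ltn_ord n)) mulr_suml.
by apply: eq_bigr => k _; rewrite mulrAC.
Qed.

(** The same cleared identity for partial sums: the sum multiplied by t stops one term earlier, so
    no boundary term remains. *)
Lemma psum_rec M N t s :
  psum M.+1 N.+1 t s - (qsq M)%:C * t * psum M.+1 N t s =
  psum M N.+1 t s - (qsq M)%:C * t * (1 - s) * psum M N t s.
Proof.
elim: N => [|N IH].
  by rewrite /psum !big_ord1 !big_ord0 !prow0 !mulr0.
have pS M' N' : psum M' N'.+1 t s = psum M' N' t s + prow M' N' s * t ^+ N'.
  by rewrite /psum big_ord_recr.
rewrite (pS M.+1 N.+1) (pS M N.+1) (pS M.+1 N) (pS M N).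
move: IH (prow_rec M N s); rewrite (pS M.+1 N) (pS M N) exprS.
move: (psum M.+1 N t s) (psum M N t s) (prow M.+1 N.+1 s) (prow M.+1 N s)
  (prow M N.+1 s) (prow M N s) (qsq M)%:C (t ^+ N) => a b c d e f q x h1 h2.
have h1' : (a + d * x - q * t * a) - (b + f * x - q * t * (1 - s) * b) = 0.
  by rewrite h1 subrr.
have h2' : (c - q * d) - (e - q * (1 - s) * f) = 0 by rewrite h2 subrr.
apply/eqP; rewrite -subr_eq0; apply/eqP.
transitivity (((a + d * x - q * t * a) - (b + f * x - q * t * (1 - s) * b))
   + ((c - q * d) - (e - q * (1 - s) * f)) * (t * x)); first by ring.
by rewrite h1' h2' mul0r addr0.
Qed.

Definition gprod M t s : R[i]^o :=
  \prod_(j < M) ((1 - (1 - s) * t * (qsq j)%:C) / (1 - t * (qsq j)%:C)).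

Lemma one_sub_neq0 (z : R[i]) : normc z < 1 -> 1 - z != 0.
Proof.
move=> z1; rewrite subr_eq0; apply/eqP => zE.
by move: z1; rewrite -zE normc1 ltxx.
Qed.

Lemma prow_term_le M n t s : normc s <= 1 ->
  normc (prow M n s * t ^+ n) <= 4 * (2 * normc t) ^+ n.
Proof.
move=> s1; rewrite normcM normcX exprMn mulrA ler_wpM2r ?exprn_ge0 ?normc_ge0//.
exact: prow_bound.
Qed.

Lemma cvg_succ (u : nat -> R[i]^o) (l : R[i]^o) :
  (u n.+1 @[n --> \oo] --> l) <-> (u @ \oo --> l).
Proof. by rewrite (cvg_shiftS u). Qed.

Lemma cvg_ratio (u v : nat -> R[i]^o) (a b : R[i]^o) : b != 0 ->
  u @ \oo --> a -> v @ \oo --> b -> u n / v n @[n --> \oo] --> a / b.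
Proof. by move=> b0 ua /(cvgV b0) h; apply: cvgM ua _; exact: h. Qed.

Lemma cvg_affine (e : R[i]^o) (u v z : nat -> R[i]^o) (c d l : R[i]^o) :
  u @ \oo --> l -> v @ \oo --> l -> z @ \oo --> (0 : R[i]^o) ->
  e * (u n - c * v n - d * z n) @[n --> \oo] --> e * (l - c * l - d * 0).
Proof.
move=> hu hv hz; apply: cvgM; first exact: cvg_cst.
apply: cvgB; last by apply: cvgM hz; exact: cvg_cst.
by apply: cvgB hu _; apply: cvgM hv; exact: cvg_cst.
Qed.

(** Induction on [M]: dividing [psum_rec] by 1 - qt expresses the new partial sums through the old
    ones, up to a multiple of the last term, which tends to 0. *)
Lemma psum_cvg M t s : normc s <= 1 -> normc t <= 4^-1 ->
  psum M N t s @[N --> \oo] --> gprod M t s.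
Proof.
move=> s1 t4; have t1 : normc t < 1 by lra.
have t0 := normc_ge0 t.
elim: M => [|M IH]; apply/(cvg_succ (fun N => psum _ N t s)).
  rewrite /gprod big_ord0 (_ : (fun N => _) = cst (1 : R[i]^o)).
    exact: cvg_cst.
  apply/funext => N; rewrite /psum big_ord_recl prow0 expr0 mulr1.
  rewrite big1 ?addr0//= => n _.
  rewrite /prow big1 ?mul0r// => k _; by rewrite mul0r.
have qt : normc (t * (qsq M)%:C) < 1.
  rewrite normcM normc_real ger0_norm ?qsq_ge0//.
  by have := ler_pM t0 (qsq_ge0 M) t4 (qsq_le1 M); lra.
have d0 := one_sub_neq0 _ qt.
have psE N : psum M.+1 N.+1 t s = (1 - t * (qsq M)%:C)^-1 *
    (psum M N.+1 t s - (qsq M)%:C * t * (1 - s) * psum M N t s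
      - (qsq M)%:C * t * (prow M.+1 N s * t ^+ N)).
  rewrite -psum_rec; apply: (mulfI d0); rewrite mulVKf//.
  rewrite /psum big_ord_recr /=.
  by move: (\sum_(n < N) _) (prow _ _ _) (t ^+ N) (qsq M)%:C => a b c d; ring.
have z0 : prow M.+1 N s * t ^+ N @[N --> \oo] --> (0 : R[i]^o).
  apply: (@normc_squeeze _ _ _ (geometric 4 (2 * normc t))) => [N|].
    by rewrite subr0 /=; exact: prow_term_le.
  by apply: cvg_geometric; rewrite ger0_norm ?mulr_ge0//; lra.
under eq_fun do rewrite psE.
have -> : gprod M.+1 t s = (1 - t * (qsq M)%:C)^-1 *
    (gprod M t s - (qsq M)%:C * t * (1 - s) * gprod M t s
      - (qsq M)%:C * t * 0).
  rewrite /gprod big_ord_recr /= mulr0 subr0.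
  by move: (\prod_(j < M) _) (1 - t * (qsq M)%:C)^-1 (qsq M)%:C => a b c; ring.
apply: (cvg_affine _ (fun N => psum M N.+1 t s) (fun N => psum M N t s)
  _ _ _ _ _ IH z0).
by apply/(cvg_succ (fun N => psum M N t s)); exact: IH.
Qed.

(** As 2|t| <= 1/2, the tail is at most 4 (2|t|)^N times a geometric sum bounded by 2. Uniformity in
    [M] permits the exchange of the limits in [M] and [N]. *)
Lemma psum_dist M N t s : normc s <= 1 -> normc t <= 4^-1 ->
  normc (psum M N t s - gprod M t s) <= 8 * (2 * normc t) ^+ N.
Proof.
move=> s1 t4; have t0 := normc_ge0 t; rewrite normcBC.
have h : psum M (i + N)%N t s @[i --> \oo] --> gprod M t s.
  by rewrite (cvg_shiftn N (fun k => psum M k t s)); exact: psum_cvg.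
apply: (@normc_lim_le _ _ (fun=> psum M N t s) _ _ _ h); first exact: cvg_cst.
move=> i; set y := 2 * normc t; have y0 : 0 <= y by rewrite mulr_ge0.
have y2 : y <= 2^-1 by rewrite /y; lra.
have -> : psum M (i + N)%N t s - psum M N t s =
    \sum_(j < i) prow M (N + j)%N s * t ^+ (N + j)%N.
  by rewrite /psum addnC big_split_ord /= addrAC subrr add0r.
apply: le_trans (normc_sum _ _ _ _) _.
apply: (@le_trans _ _ (\sum_(j < i) 4 * y ^+ N * 2^-1 ^+ j)).
  apply: ler_sum => j _; apply: le_trans (prow_term_le _ _ _ _ s1) _.
  rewrite exprD mulrA ler_wpM2l ?mulr_ge0 ?exprn_ge0//.
  by rewrite lerXn2r// nnegrE invr_ge0.
have y0N : 0 <= 4 * y ^+ N by rewrite mulr_ge0 ?exprn_ge0.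
by rewrite -mulr_sumr; have := ler_wpM2l y0N (@sum_half_le R i); lra.
Qed.

Lemma real_complex_cvg (u : nat -> R) (l : R) :
  u @ \oo --> l -> ((u n)%:C : R[i]^o) @[n --> \oo] --> (l%:C : R[i]^o).
Proof.
move=> ul; apply/cvg_normc; under eq_fun do rewrite -rmorphB normc_real.
rewrite -(normr0 R^o) -(subrr l); apply: cvg_norm.
by apply: cvgB => //; exact: cvg_cst.
Qed.

Lemma psum_limit N t s : psum M N t s @[M --> \oo] -->
  (\sum_(n < N) \sum_(k < N) (F_coef R n k)%:C * t ^+ n * s ^+ k : R[i]^o).
Proof.
under eq_fun do rewrite psum_square.
apply: (@cvg_sum R[i] R[i]^o) => n _; apply: (@cvg_sum R[i] R[i]^o) => k _.
apply: cvgM; last exact: cvg_cst.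
apply: cvgM; last exact: cvg_cst.
by apply: real_complex_cvg; exact: pcoef_cvg.
Qed.

(** The coefficients [pcoef M n k] are nonnegative, so each is at most their sum [prow M n 1]; the
    bound passes to the limit. *)
Lemma F_coef_bound n k : `|F_coef R n k| <= 4 * 2 ^+ n.
Proof.
have h := @pcoef_cvg R n k; have c : cvgn (fun M => pcoef M n k : R).
  by apply/cvg_ex; exists (F_coef R n k).
rewrite -(cvg_lim (@Rhausdorff R) h) ger0_norm; last first.
  by apply: limr_ge => //; apply: nearW => M; exact: pcoef_ge0.
apply: limr_le => //; apply: nearW => M.
case: (ltnP n k) => [nk|kn]; first by rewrite pcoef_eq0// mulr_ge0// exprn_ge0.
have := prow_bound M n 1; rewrite normc1 lexx => /(_ isT); apply: le_trans.
rewrite /prow; under eq_bigr do rewrite expr1n mulr1.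
rewrite -rmorph_sum normc_real ger0_norm; last first.
  by apply: sumr_ge0 => j _; exact: pcoef_ge0.
rewrite (bigD1 (Ordinal (kn : (k < n.+1)%N)))//= lerDl.
by apply: sumr_ge0 => j _; exact: pcoef_ge0.
Qed.

Lemma esum_half_le : (\esum_(k in [set: nat]) ((2^-1 : R) ^+ k)%:E <= 2%:E)%E.
Proof.
rewrite -nneseries_esumT => [|k]; last by rewrite lee_fin exprn_ge0// invr_ge0.
apply: lime_le.
  by apply: is_cvg_nneseries => k _ _; rewrite lee_fin exprn_ge0// invr_ge0.
by apply: nearW => n; rewrite sumEFin lee_fin big_mkord sum_half_le.
Qed.

(** By [F_coef_bound] and |t|, |s| <= 1/4 the terms are dominated by 4 2^-n 2^-k. *)
Lemma F_coef_summable t s : normc s <= 4^-1 -> normc t <= 4^-1 ->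
  summable [set: nat * nat]
    (fun p => (complex.Re `|(F_coef R p.1 p.2)%:C * t ^+ p.1 * s ^+ p.2|)%:E).
Proof.
move=> s4 t4; rewrite /summable.
have half0 k : 0 <= (2^-1 : R) ^+ k by rewrite exprn_ge0// invr_ge0.
apply: (@le_lt_trans _ _
  (\esum_(p in [set: nat * nat]) (4 * 2^-1 ^+ p.1 * 2^-1 ^+ p.2 : R)%:E)%E).
  apply: le_esum => -[n k] _; rewrite norm_normc /= lee_fin.
  rewrite ger0_norm ?normc_ge0//.
  rewrite !normcM !normcX normc_real; apply: ler_pM => //.
  - by rewrite mulr_ge0// exprn_ge0// normc_ge0.
  - by rewrite exprn_ge0// normc_ge0.
  - apply: (@le_trans _ _ (4 * 2 ^+ n * normc t ^+ n)).
      by rewrite ler_wpM2r ?exprn_ge0 ?normc_ge0// F_coef_bound.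
    rewrite -mulrA -exprMn ler_wpM2l//.
    rewrite lerXn2r ?nnegrE ?mulr_ge0 ?normc_ge0 ?invr_ge0//.
    by lra.
  - by rewrite lerXn2r ?nnegrE ?normc_ge0 ?invr_ge0//; lra.
have := @esum_esum R nat nat setT (fun=> setT)
  (fun n k => (4 * 2^-1 ^+ n * 2^-1 ^+ k)%:E).
rewrite (_ : setT `*`` (fun=> setT) = setT); last by apply/seteqP; split.
move=> <- => [|n k _ _]; last by rewrite lee_fin !mulr_ge0.
apply: (@le_lt_trans _ _
  (\esum_(n in [set: nat]) (8%:E * ((2^-1 : R) ^+ n)%:E))%E).
  apply: le_esum => n _; under eq_esum do rewrite EFinM.
  apply: le_trans (le_esumZ _ _ _ _ _ _) _.
  - by rewrite mulr_ge0.
  - by move=> k; rewrite lee_fin.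
  apply: le_trans (lee_wpmul2l _ esum_half_le) _.
    by rewrite lee_fin mulr_ge0.
  by rewrite -!EFinM lee_fin; lra.
apply: le_lt_trans (le_esumZ _ _ _ _ _ _) _ => //.
apply: le_lt_trans (lee_wpmul2l _ esum_half_le) _; first by rewrite lee_fin.
by rewrite -EFinM ltry.
Qed.
End GeneratingFunction.

(** * The closed form of the generating function *)

Theorem theorem2 (R : realType) :
  power_series_expansion (F_coef R)
    (fun t s : R[i] =>
       csin ((pi : R)%:C * sqrtC (1 - s) * sqrtC t)
       / (sqrtC (1 - s) * csin ((pi : R)%:C * sqrtC t))).
Proof.
(* Since |1-s| <= 2, the radius 1/64 keeps both t and (1-s)t within 1/32, where [euler_product]
   applies. *)
exists 64^-1; first by rewrite invr_gt0.
move=> t s t0; rewrite !norm_normc !ltcR => t64 s64.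
have [tn0 sn0] := (normc_ge0 t, normc_ge0 s).
split; first by apply: F_coef_summable; lra.
pose w := (1 - s) * t.
have t32 : normc t <= 32^-1 by lra.
have w32 : normc w <= 32^-1.
  have h : normc (1 - s) <= 2.
    by apply: le_trans (le_normcD _ _) _; rewrite normc1 normcN; lra.
  by rewrite /w normcM; have := ler_pM (normc_ge0 _) tn0 h (ltW t64); lra.
have [l2 hl2] := sinc_cvg _ (pi2_normc _ t32).
have [l1 hl1] := sinc_cvg _ (pi2_normc _ w32).
have pt := euler_product _ _ t32 hl2.
have pw := euler_product _ _ w32 hl1.
(* By [prod_lower] the products converging to [l2] have modulus at least 1/2. *)
have l20 : l2 != 0.
  apply/eqP => l2E; move/cvg_normc: pt; rewrite l2E => h.
  have : 2^-1 <= limn (fun m : nat =>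
      normc (\prod_(j < m) (1 - t * (j.+1%:R ^- 2)%:C) - 0)).
    apply: limr_ge; first by apply/cvg_ex; exists 0.
    by apply: nearW => m; rewrite subr0 prod_lower.
  by rewrite (cvg_lim (@Rhausdorff R) h); lra.
have s1 : 1 - s != 0 by apply: one_sub_neq0; lra.
(* [csin_sinc] applies to sqrt(t) and to sqrt(1-s) sqrt(t), a square root of [w]; pi and both roots
   then cancel, being nonzero. *)
have -> : csin ((pi : R)%:C * sqrtC (1 - s) * sqrtC t)
    / (sqrtC (1 - s) * csin ((pi : R)%:C * sqrtC t)) = l1 / l2.
  rewrite (csin_sinc _ _ _ (sqrtCK t) hl2) -mulrA.
  rewrite (csin_sinc _ w _ _ hl1); last by rewrite exprMn !sqrtCK.
  have u0 : sqrtC (1 - s) != 0 by rewrite sqrtC_eq0.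
  have v0 : sqrtC t != 0 by rewrite sqrtC_eq0.
  have p0 : (pi : R)%:C != 0 by rewrite fmorph_eq0 gt_eqF ?pi_gt0.
  by move: (sqrtC (1 - s)) (sqrtC t) (pi%:C) u0 v0 p0 => a b c a0 b0 c0; field;
    rewrite a0 b0 c0 l20.
have hg : (gprod M t s @[M --> \oo] --> (l1 / l2 : R[i]^o))%classic.
  have gE M : gprod M t s = (\prod_(j < M) (1 - w * (j.+1%:R ^- 2)%:C)) /
      (\prod_(j < M) (1 - t * (j.+1%:R ^- 2)%:C)).
    by rewrite /gprod prodf_div.
  under eq_fun do rewrite gE.
  exact: (cvg_ratio _ _ _ _ l20 pw pt).
(* Letting [M] tend to infinity in [psum_dist] bounds the distance from the square partial sums to
   [l1 / l2] by 8 (2|t|)^N. *)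
apply: (@normc_squeeze _ _ _ (geometric 8 (2 * normc t))) => [N|].
  apply: (normc_lim_le _ _ _ _ _ (psum_limit N t s) hg) => M.
  by apply: psum_dist; lra.
by apply: cvg_geometric; rewrite ger0_norm ?mulr_ge0//; lra.
Qed.
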